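(* (i) Every regular fusible module over a right duo ring is nonsingular. (ii) Every regular fusible module over a commutative ring is nonsingular.
   Context: Rings are associative with identity; modules are unital right modules. A ring $R$ is right duo if $Ra\subseteq aR$ for every $a\in R$. Let $M$ be a right $R$-module. For $m\in M$, $ann_R(m)=\{r\in R: mr=0\}$. $T_R(M)=\{m\in M: ann_R(m)\neq 0\}$ is the set of torsion elements, $T_R^{\star}(M)=\{m\in M: ann_R(m)=0\}$ the set of torsion free elements, and $Zd(M)=\{r\in R: mr=0\text{ for some }0\neq m\in M\}$. An element of $M$ is fusible if it can be written as $x+y$ with $x\in T_R(M)$ and $y\in T_R^{\star}(M)$. A nonzero $m\in M$ is regular fusible if there exists $r\in R-Zd(M)$ such that $mr$ is fusible; $M$ is a regular fusible module if every nonzero element of $M$ is regular fusible. An ideal $I$ of $R$ is essential, written $I\leq_e R$, if $I\cap J\neq 0$ for every nonzero ideal $J$ of $R$ (over a right duo ring every right ideal is two-sided, so there is no ambiguity). $Z(M)=\{m\in M: ann_R(m)\leq_e R\}$, and $M$ is nonsingular if $Z(M)=0$. *)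

(* Defs.v *)
From HB Require Import structures.
From mathcomp Require Import all_boot all_order all_algebra.
From mathcomp Require Import boolp classical_sets.

Set Implicit Arguments.
Unset Strict Implicit.
Unset Printing Implicit Defensive.

Import GRing.Theory.
Local Open Scope classical_set_scope.
Local Open Scope ring_scope.

(* A right R-module is a left module over the converse ring R^c. Rings are
   [pzRingType]s: the zero ring is allowed. *)
Definition ract (R : pzRingType) (M : lmodType R^c) (m : M) (r : R) : M :=
  (r : R^c) *: m.

Notation "m *> r" := (ract m r) (at level 40, left associativity) : ring_scope.

Lemma ractA (R : pzRingType) (M : lmodType R^c) (m : M) (r s : R) :
  m *> (r * s) = m *> r *> s.
Proof. by rewrite /ract scalerA. Qed.

Definition right_duo (R : pzRingType) : Prop :=
  forall a : R, [set r * a | r in [set: R]] `<=` [set a * r | r in [set: R]].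

Definition ideal (R : pzRingType) (I : set R) : Prop :=
  [/\ I 0,
      forall x y, I x -> I y -> I (x - y),
      forall r x, I x -> I (r * x)
    & forall r x, I x -> I (x * r)].

Definition essential (R : pzRingType) (I : set R) : Prop :=
  ideal I /\
  forall J : set R, ideal J -> J <> [set 0] -> I `&` J <> [set 0].

Section RightModule.
Variables (R : pzRingType) (M : lmodType R^c).

Definition ann (m : M) : set R := [set r | m *> r = 0].

Definition torsion : set M := [set m | ann m <> [set 0]].

Definition torsion_free : set M := [set m | ann m = [set 0]].

Definition Zd : set R := [set r | exists2 m : M, m <> 0 & m *> r = 0].

Definition fusible (m : M) : Prop :=
  exists x y : M, [/\ torsion x, torsion_free y & m = x + y].

Definition regular_fusible (m : M) : Prop :=
  exists2 r : R, (~` Zd) r & fusible (m *> r).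

Definition regular_fusible_module : Prop :=
  forall m : M, m <> 0 -> regular_fusible m.

Definition singular_set : set M := [set m | essential (ann m)].

Definition nonsingular : Prop := singular_set = [set 0].

End RightModule.

Arguments Zd {R} M.
Arguments regular_fusible_module {R} M.
Arguments singular_set {R} M.
Arguments nonsingular {R} M.

(* Over a right duo ring the condition [ideal (ann m)] contained in
   [essential (ann m)] is automatic. *)
Lemma right_duo_ideal_ann (R : pzRingType) (M : lmodType R^c) (m : M) :
  right_duo R -> ideal (ann m).
Proof.
move=> duoR; split=> [|x y|r x|r x]; rewrite /ann /=.
- exact: scale0r.
- by rewrite /ract => mx my; rewrite scalerBl mx my subrr.
- move=> mx; have [s _ <-] := duoR x (r * x) (ex_intro2 _ _ r I erefl).
  by rewrite ractA mx /ract scaler0.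
- by move=> mx; rewrite ractA mx /ract scaler0.
Qed.

(* Main.v *)
Require Import Defs.
From mathcomp Require Import all_boot all_order all_algebra.
From mathcomp Require Import boolp classical_sets.

(** A nonzero singular element [m] cannot be regular fusible. Suppose
    [m *> r = x + y] with [x] torsion and [y] torsion free. Over a right duo
    ring [ann x] is a nonzero two-sided ideal, so it meets the essential ideal
    [ann m] in some [s <> 0]. As [ann m] is also a left ideal, it contains
    [r * s], so [s] kills [m *> r]; it kills [x] too, hence it kills the
    difference [y], which contradicts torsion freeness
    ([fusible_multiple_not_singular]). A commutative ring is right duo. *)

Set Implicit Arguments.
Unset Strict Implicit.
Unset Printing Implicit Defensive.

Import GRing.Theory.
Local Open Scope classical_set_scope.
Local Open Scope ring_scope.

Lemma com_right_duo (R : comPzRingType) : right_duo R.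
Proof. by move=> a _ [r _ <-]; exists r => //; rewrite mulrC. Qed.

Lemma ideal_setT (R : pzRingType) : ideal [set: R].
Proof. by []. Qed.

Lemma singular_set0 (R : pzRingType) (M : lmodType R^c) :
  singular_set M (0 : M).
Proof.
have -> : singular_set M 0 = essential [set: R].
  congr essential; apply/seteqP; split=> // r _.
  by rewrite /ann /= /ract scaler0.
by split=> [|J _]; [exact: ideal_setT | rewrite setTI].
Qed.

(** The annihilator of [x] serves as the test ideal for the essentiality of
    [ann m]: whatever kills both [m] and [x] also kills
    [y = m *> r - x], hence is zero. *)
Lemma fusible_multiple_not_singular (R : pzRingType) (M : lmodType R^c)
    (m : M) (r : R) :
  right_duo R -> fusible (m *> r) -> ~ singular_set M m.
Proof.
move=> duoR [x [y [tx ty mrE]]] [[ann0 _ annMl _] ess].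
apply: (ess _ (right_duo_ideal_ann x duoR) tx).
apply/seteqP; split=> [s [ms xs]|_ ->]; last by split=> //; exact: scale0r.
rewrite -ty /ann /=.
have := annMl r s ms; rewrite /ann /= ractA mrE /ract scalerDr.
by move: xs; rewrite /ann /= /ract => ->; rewrite add0r.
Qed.

Lemma right_duo_regular_fusible_nonsingular (R : pzRingType)
    (M : lmodType R^c) :
  right_duo R -> regular_fusible_module M -> nonsingular M.
Proof.
move=> duoR rfM; apply/seteqP; split=> [m sm|_ ->]; last exact: singular_set0.
apply: contrapT => /rfM [r _ fr].
exact: (fusible_multiple_not_singular duoR fr).
Qed.

Theorem corollary2 :
  (forall (R : pzRingType) (M : lmodType R^c),
     right_duo R -> regular_fusible_module M -> nonsingular M) /\
  (forall (R : comPzRingType) (M : lmodType R^c),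
     regular_fusible_module M -> nonsingular M).
Proof.
split=> R M; first exact: right_duo_regular_fusible_nonsingular.
by apply: right_duo_regular_fusible_nonsingular; exact: com_right_duo.
Qed.
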